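(* We have $$\mu(3;\varepsilon)=\begin{cases} 4, & \varepsilon\in[3/4,1);\\ 5, & \varepsilon\in[2/3,3/4);\\ 7, & \varepsilon\in[3/5,2/3);\\ 8, & \varepsilon\in[1/2,3/5).\end{cases}$$
   Context: For a positive integer $d$ and a real $\varepsilon\in(0,1)$, let $T^d=[\mathbb{R}/\mathbb{Z}]^d$ be the $d$-dimensional torus. An $\varepsilon$-sub-cube of $T^d$ is a set of the form $\{(x_1,\ldots,x_d): x_i\in[x_i^0,x_i^0+\varepsilon] \text{ for all } i\}$, where $x_1^0,\dots,x_d^0\in\mathbb{R}/\mathbb{Z}$ and $[x_i^0,x_i^0+\varepsilon]$ denotes the image in $\mathbb{R}/\mathbb{Z}$ of the corresponding closed real interval of length $\varepsilon$. $\mu(d;\varepsilon)$ denotes the minimum number of $\varepsilon$-sub-cubes whose union is $T^d$. *)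

(* Defs.v *)
From HB Require Import structures.
From mathcomp Require Import all_boot all_order all_algebra ring_quotient.
From mathcomp Require Import boolp classical_sets reals.
Set Implicit Arguments.
Unset Strict Implicit.
Unset Printing Implicit Defensive.
Import Order.TTheory GRing.Theory Num.Theory.
Local Open Scope classical_set_scope.
Local Open Scope quotient_scope.
Local Open Scope ring_scope.

(* [Num.int_num_subdef] is the predicate behind the qualifier [Num.int]; this is
   the subgroup Z of R. *)
Definition int_subgroup (R : realType) : zmodClosed R :=
  GRing.ZmodClosed.clone R (@Num.int_num_subdef R) _.

(* The additive group R/Z. *)
Definition circle (R : realType) : Type := Quotient.quot (int_subgroup R).

HB.instance Definition _ (R : realType) := GRing.Zmodule.on (circle R).
HB.instance Definition _ (R : realType) :=
  EqQuotient.copy (circle R) (Quotient.quot (int_subgroup R)).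

Definition torus (R : realType) (d : nat) : Type := {ffun 'I_d -> circle R}.

(* The arc [x0, x0 + eps]. The choice of the lift [repr x0] of x0 to R is
   immaterial: see [circle_arc_pi]. *)
Definition circle_arc (R : realType) (eps : R) (x0 : circle R) : set (circle R) :=
  \pi_(circle R) @` [set t : R | repr x0 <= t <= repr x0 + eps].

Lemma circle_eqP (R : realType) (a b : R) :
  reflect (\pi_(circle R) a = \pi_(circle R) b) (a - b \is a Num.int).
Proof.
rewrite unfold_in -[Num.int_num_subdef _]/(a - b \in int_subgroup R).
by rewrite Quotient.idealrBE; exact: eqP.
Qed.

Lemma circle_arc_pi (R : realType) (eps a : R) :
  circle_arc eps (\pi_(circle R) a) = \pi_(circle R) @` [set t : R | a <= t <= a + eps].
Proof.
have ra : repr (\pi_(circle R) a) - a \is a Num.int.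
  by apply/circle_eqP; rewrite reprK.
rewrite /circle_arc; move: (repr _) ra => b ba.
apply/seteqP; split=> _ [t /= /andP[t1 t2] <-].
  exists (t - (b - a)).
    by rewrite /= lerBrDl subrK t1 /= lerBlDl addrA subrK.
  by apply/circle_eqP; rewrite addrAC subrr sub0r rpredN.
exists (t + (b - a)).
  by rewrite /= addrCA lerDl lerD2l subr_ge0 lerBlDl t1.
by apply/circle_eqP; rewrite addrAC subrr add0r.
Qed.

Definition subcube (R : realType) (d : nat) (eps : R) (x0 : torus R d) :
    set (torus R d) :=
  [set x : torus R d | forall i, circle_arc eps (x0 i) (x i)].

Definition coverable (R : realType) (d : nat) (eps : R) (n : nat) : Prop :=
  exists c : 'I_n -> torus R d, \bigcup_i subcube eps (c i) = setT.

(* The least n such that n eps-sub-cubes cover the torus. The default value 0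
   is never the covering number, the torus being nonempty. *)
Definition mu (R : realType) (d : nat) (eps : R) : nat :=
  xget 0%N [set n | coverable d eps n /\
                    forall m, coverable d eps m -> (n <= m)%N].

(* Main.v *)
Require Import Defs.
From mathcomp Require Import all_boot all_order all_algebra.
From mathcomp Require Import boolp classical_sets reals.
From mathcomp Require Import zify ring lra.
Set Implicit Arguments.
Unset Strict Implicit.
Unset Printing Implicit Defensive.
Import Order.TTheory GRing.Theory Num.Theory.
Local Open Scope ring_scope.

(** The upper bounds come from coverings of the discrete torus (Z/q)^3 by cubes
    of side r with r/q = 3/4, 2/3, 3/5, 1/2: rounding a point of the torus down
    to the grid of step 1/q turns them into coverings by cubes of side r/q
    ([grid_cover]).

    For the lower bounds, look at the complement of each arc: an open arc of
    length delta = 1 - eps.  A point (x, y, z) is outside the i-th cube as soon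
    as x, y or z pierces the i-th complementary arc of its own coordinate.  So
    n cubes do not cover if x, y, z can be chosen to pierce, between them, all
    n indices.  If n delta > k, some point lies in k + 1 of n given arcs of
    length delta ([pierce_down]): sort the starting points cyclically; if no
    k + 1 consecutive arcs shared a point, then jumping n times by k places
    would advance by at least n delta, whereas it amounts to k turns.  Choosing
    x, y, z greedily disposes of 3 cubes (delta > 0), 4 cubes (delta > 1/4) and
    6 cubes (delta > 1/3); see [not_unpierced_greedy].

    The remaining case, 7 cubes and delta > 2/5, is finer.  No x can lie in four
    arcs, for the other three indices could then be pierced by y and z
    ([depth_le3]).  With seven arcs of length more than 2/5 and no point in four
    of them, the combinatorics is rigid: in the cyclic order of the starting
    points, any three consecutive arcs share a point ([cyclic_triples]).  Thus
    each coordinate supplies a cyclic ordering of the seven indices, in which two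
    indices at cyclic distance 1 or 2 can be pierced together; call them near,
    and call them far if their distance is 3.

    It is then enough to show that for any three cyclic orders on seven indices
    some window Q of four consecutive indices for the first order splits into
    two pairs, one near for the second order and the other near for the third
    ([three_cyclic_orders]): the three indices outside Q are pierced by x, and
    the pairs by y and z.  Suppose not.  The three splittings of Q into two
    pairs, each used both ways, show that Q has at least 6 far pairs in the two
    orders together, while four indices have at most 3 far pairs in one order;
    so there are exactly 3 in each.  Sum this over the seven windows Q: a pair at
    distance t = 1, 2, 3 in the first order belongs to 4 - t of them, and there
    are 7 far pairs, so the total 21 forces every far pair to be at distance 1
    ([tight_windows]).  Hence in Q = {0, 1, 2, 3} the pair {0, 2} is near for the
    second order and {1, 3} is near for the third, a contradiction. *)

(** * Three cyclic orders on seven indices *)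

(** An explicit list, so that statements quantified over Z/7 can be decided by
    evaluation. *)
Definition I7 : seq 'I_7 := [seq inZp i | i <- iota 0 7].

Lemma all_I7P (P : pred 'I_7) : all P I7 -> forall i, P i.
Proof.
move=> /allP allP i; apply: allP; apply/mapP; exists (nat_of_ord i).
  by rewrite mem_iota ltn_ord.
by rewrite valZpK.
Qed.
Arguments all_I7P [P] _ i.

Lemma sum_I7 (F : 'I_7 -> nat) :
  (\sum_(i : 'I_7) F i
     = F 0%R + F 1%R + F 2%R + F 3%R + F 4%R + F 5%R + F 6%R)%N.
Proof.
rewrite !big_ord_recl big_ord0 addn0 !addnA.
by congr (_ + _ + _ + _ + _ + _ + _)%N; congr F; apply: val_inj.
Qed.

Definition far (i j : 'I_7) : bool := (i - j == 3) || (j - i == 3).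

Lemma farC i j : far i j = far j i.
Proof. by rewrite /far orbC. Qed.

(** The far pairs form a 7-cycle, and a proper subset of a cycle spans a forest. *)
Lemma far_four (a b c d : 'I_7) : uniq [:: a; b; c; d] ->
  (far a b + far a c + far a d + far b c + far b d + far c d <= 3)%N.
Proof.
apply/implyP.
have : all (fun a => all (fun b => all (fun c => all (fun d =>
    uniq [:: a; b; c; d] ==>
    (far a b + far a c + far a d + far b c + far b d + far c d <= 3)%N)
  I7) I7) I7) I7 by vm_compute.
by move=> /all_I7P/(_ a)/all_I7P/(_ b)/all_I7P/(_ c)/all_I7P/(_ d).
Qed.

Lemma near_window (i j : 'I_7) : ~~ far i j ->
  exists k : 'I_7,
    (i \in [:: k; k + 1; k + 2]) && (j \in [:: k; k + 1; k + 2]).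
Proof.
move=> nij.
suff /hasP[k _ kij] : has (fun k : 'I_7 =>
    (i \in [:: k; k + 1; k + 2]) && (j \in [:: k; k + 1; k + 2])) I7 by exists k.
move: nij; apply/implyP.
have : all (fun i => all (fun j => ~~ far i j ==> has (fun k : 'I_7 =>
  (i \in [:: k; k + 1; k + 2]) && (j \in [:: k; k + 1; k + 2])) I7) I7) I7
  by vm_compute.
by move=> /all_I7P/(_ i)/all_I7P/(_ j).
Qed.

(** Here r sends the position of an index in a first cyclic order to its
    position in a second one; the value is a number since these are summed. *)
Definition far_img (r : 'I_7 -> 'I_7) (i j : 'I_7) : nat := far (r i) (r j).
Arguments far_img r (i j)%_R.

Definition window_far (r : 'I_7 -> 'I_7) (i : 'I_7) : nat :=
  far_img r i (i + 1) + far_img r i (i + 2) + far_img r i (i + 3)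
  + far_img r (i + 1) (i + 2) + far_img r (i + 1) (i + 3)
  + far_img r (i + 2) (i + 3).

Section FarPairs.
Variable r : 'I_7 -> 'I_7.
Hypothesis r_inj : injective r.

Definition far_at (t : 'I_7) : nat := \sum_(i : 'I_7) far_img r i (i + t).
Arguments far_at t%_R.

Lemma far_at0 : far_at 0 = 0%N.
Proof. by rewrite /far_at big1 // => i _; rewrite addr0 /far_img /far subrr. Qed.

Lemma far_atN t : far_at (- t) = far_at t.
Proof.
rewrite /far_at (reindex_inj (addIr t)); apply: eq_bigr => i _.
by rewrite addrK /far_img farC.
Qed.

(** There are 7 far pairs, hence 14 ordered ones; the shifts t and - t
    contribute equally. *)
Lemma far_at_sum : (far_at 1 + far_at 2 + far_at 3 = 7)%N.
Proof.
have sum14 : (\sum_(t : 'I_7) far_at t = 14)%N.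
  have -> : (\sum_(t : 'I_7) far_at t
             = \sum_(i : 'I_7) \sum_(j : 'I_7) far i j)%N.
    rewrite /far_at exchange_big [RHS](reindex_inj r_inj).
    apply: eq_bigr => i _.
    by rewrite [RHS](reindex_inj (inj_comp r_inj (addrI i))).
  by rewrite !sum_I7; vm_compute.
move: sum14; rewrite sum_I7 far_at0.
have -> : far_at 4 = far_at 3
  by rewrite -far_atN; congr far_at; apply: val_inj.
have -> : far_at 5 = far_at 2
  by rewrite -far_atN; congr far_at; apply: val_inj.
have -> : far_at 6 = far_at 1
  by rewrite -far_atN; congr far_at; apply: val_inj.
by lia.
Qed.

(** A pair at distance t lies in 4 - t windows, so the windows contain
    3 far_at 1 + 2 far_at 2 + far_at 3 <= 3 * 7 far pairs in all; the hypothesis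
    says that this is an equality, and then far_at 2 = 0. *)
Lemma tight_windows :
  (forall i, 3 <= window_far r i)%N ->
  forall i, ~~ far (r i) (r (i + 2)).
Proof.
move=> tight i.
have shift u t v : u + t = v ->
    (\sum_(i : 'I_7) far_img r (i + u) (i + v) = far_at t)%N.
  move=> <-; rewrite /far_at [RHS](reindex_inj (addIr u)).
  by apply: eq_bigr => j _; rewrite addrA.
have windowsE : (\sum_(i : 'I_7) window_far r i
                 = 3 * far_at 1 + 2 * far_at 2 + far_at 3)%N.
  rewrite /window_far !big_split /= -/(far_at 1) -/(far_at 2) -/(far_at 3).
  rewrite (shift 1 1 2) ?(shift 1 2 3) ?(shift 2 1 3); [lia| exact: val_inj..].
have : (\sum_(i : 'I_7) 3 <= \sum_(i : 'I_7) window_far r i)%N.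
  by apply: leq_sum => j _; exact: tight.
rewrite windowsE sum_nat_const card_ord; have := far_at_sum => ? ?.
have : far_at 2 = 0%N by lia.
by move/eqP; rewrite sum_nat_eq0 => /forallP/(_ i); rewrite /far_img; case: far.
Qed.

End FarPairs.

(** The first cyclic order is that of Z/7 itself; r2 and r3 give the positions
    in the two other ones. *)
Lemma three_cyclic_orders (r2 r3 : 'I_7 -> 'I_7) :
  injective r2 -> injective r3 ->
  exists i a b c d : 'I_7,
    [/\ perm_eq [:: a; b; c; d] [:: i; i + 1; i + 2; i + 3],
        ~~ far (r2 a) (r2 b) & ~~ far (r3 c) (r3 d)].
Proof.
move=> r2i r3i; apply: contrapT => no.
have split (i a b c d : 'I_7) :
    perm_eq [:: a; b; c; d] [:: i; i + 1; i + 2; i + 3] ->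
    (1 <= far_img r2 a b + far_img r3 c d)%N.
  rewrite /far_img => abcd.
  case f2: (far (r2 a) (r2 b)) => //; case f3: (far (r3 c) (r3 d)) => //.
  by case: no; exists i, a, b, c, d; rewrite f2 f3.
have window_uniq (i : 'I_7) : uniq [:: i; i + 1; i + 2; i + 3].
  rewrite -{1}[i]addr0; have -> : [:: i + 0; i + 1; i + 2; i + 3] =
    map (+%R i) [:: 0; 1; 2; 3] by [].
  by rewrite map_inj_uniq //; exact: addrI.
have four2 i : (window_far r2 i <= 3)%N.
  by apply: far_four; rewrite (map_inj_uniq r2i [:: i; i + 1; i + 2; i + 3]).
have four3 i : (window_far r3 i <= 3)%N.
  by apply: far_four; rewrite (map_inj_uniq r3i [:: i; i + 1; i + 2; i + 3]).
have pairings i :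
  [/\ (1 <= far_img r2 i (i + 1) + far_img r3 (i + 2) (i + 3))%N,
      (1 <= far_img r2 i (i + 2) + far_img r3 (i + 1) (i + 3))%N &
      (1 <= far_img r2 i (i + 3) + far_img r3 (i + 1) (i + 2))%N] /\
  [/\ (1 <= far_img r2 (i + 1) (i + 2) + far_img r3 i (i + 3))%N,
      (1 <= far_img r2 (i + 1) (i + 3) + far_img r3 i (i + 2))%N &
      (1 <= far_img r2 (i + 2) (i + 3) + far_img r3 i (i + 1))%N].
  split; split; apply: (split i); apply/permP => P /=; ring.
(* Each window has at least 6 far pairs in all and at most 3 in one of the
   orders, hence at least 3 in the other. *)
have near2 : ~~ far (r2 0) (r2 (0 + 2)).
  apply: (tight_windows r2i) => i; have := four3 i.
  by have [[? ? ?] [? ? ?]] := pairings i; rewrite /window_far; lia.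
have near3 : ~~ far (r3 1) (r3 (1 + 2)).
  apply: (tight_windows r3i) => i; have := four2 i.
  by have [[? ? ?] [? ? ?]] := pairings i; rewrite /window_far; lia.
by case: no; exists 0, 0, (0 + 2), 1, (1 + 2).
Qed.

(** * Piercing open arcs of a circle *)

Section Piercing.
Variables (R : realType) (delta : R).

(** The circle is handled through its universal cover: x belongs to the open arc
    of length delta starting at p, modulo 1. *)
Definition pierces (p x : R) : Prop :=
  exists m : int, p + m%:~R < x < p + m%:~R + delta.

Lemma piercesZ (p x : R) (m : int) : pierces (p + m%:~R) x -> pierces p x.
Proof. by move=> [k kx]; exists (m + k); rewrite intrD addrA. Qed.

(** The points p i, modulo 1, are listed along the line in increasing order as
    q 0, q 1, ...; going once around the circle adds 1 to q and repeats the
    labels s. *)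
Lemma cyclic_sort (n : nat) (p : 'I_n.+1 -> R) :
  exists (s : nat -> 'I_n.+1) (q : nat -> R),
  [/\ {homo q : i j / (i <= j)%N >-> i <= j},
      forall i, q (i + n.+1)%N = q i + 1,
      forall i, exists m : int, q i = p (s i) + m%:~R &
      forall i j, s i = s j <-> i = j %[mod n.+1]].
Proof.
pose f i : R := p i - (Num.floor (p i))%:~R.
have f01 i : 0 <= f i < 1.
  by have := floor_itv (p i); rewrite /f intrD; lra.
pose le_f := relpre f <=%O.
have le_f_trans : transitive le_f by move=> j i k; exact: le_trans.
pose l := sort le_f (enum 'I_n.+1).
have sl : size l = n.+1 by rewrite size_sort size_enum_ord.
have l_sorted : sorted le_f l by apply: sort_sorted => i j; exact: le_total.
have l_uniq : uniq l by rewrite sort_uniq enum_uniq.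
pose s i := nth ord0 l (i %% n.+1).
exists s, (fun i => f (s i) + (i %/ n.+1)%N%:R); split.
- apply: homo_leq => [x|y x z|i]; [exact: lexx|exact: le_trans|].
  have := divn_eq i n.+1; have := ltn_pmod i (ltn0Sn n).
  rewrite /s; move: (i %/ n.+1)%N (i %% n.+1)%N => a b bn ->.
  have [bn'|bn'] := ltnP b.+1 n.+1.
    rewrite -addnS divnMDl // divn_small // modnMDl modn_small //.
    rewrite addn0 lerD2r.
    have := sorted_leq_nth le_f_trans (fun x => lexx (f x)) ord0 l_sorted.
    by apply; rewrite ?inE ?sl.
  (* a new turn begins: the fractional part restarts below 1 *)
  have -> : ((a * n.+1 + b).+1 = a.+1 * n.+1)%N by lia.
  rewrite mulnK // modnMl.
  have := f01 (nth ord0 l b); have := f01 (nth ord0 l 0).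
  by rewrite -[a.+1%:R]natr1; lra.
- by move=> i; rewrite /s modnDr divnDr // divnn /= natrD addrA.
- move=> i; exists ((i %/ n.+1)%N%:Z - Num.floor (p (s i))).
  by rewrite /f intrB; lra.
- move=> i j; split=> [/eqP|]; last by rewrite /s => ->.
  by rewrite /s nth_uniq ?sl ?ltn_pmod // => /eqP.
Qed.

(** If the last of k + 1 consecutive arcs starts before the first one ends, any
    point between that start and that end is in all of them. *)
Lemma window_pierced (n : nat) (p : 'I_n.+1 -> R) (s : nat -> 'I_n.+1)
    (q : nat -> R) (i k : nat) :
  {homo q : i j / (i <= j)%N >-> i <= j} ->
  (forall i, exists m : int, q i = p (s i) + m%:~R) ->
  q (i + k)%N < q i + delta ->
  exists x, forall t, (t <= k)%N -> pierces (p (s (i + t)%N)) x.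
Proof.
move=> qle qp ltk; exists ((q (i + k)%N + (q i + delta)) / 2) => t tk.
have [m qm] := qp (i + t)%N; apply: (@piercesZ _ _ m); rewrite -qm.
exists 0; rewrite mulr0z addr0.
have := qle i (i + t)%N (leq_addr _ _).
have := qle (i + t)%N (i + k)%N; rewrite leq_add2l => /(_ tk).
by lra.
Qed.

(** Otherwise n jumps by k places would advance by at least n * delta, but they
    make exactly k turns. *)
Lemma crowded_window (n k : nat) (q : nat -> R) :
  (forall i, q (i + n)%N = q i + 1) -> k%:R < n%:R * delta ->
  exists i, q (i + k)%N < q i + delta.
Proof.
move=> qn kn; apply: contrapT => no.
have step i : q i + delta <= q (i + k)%N.
  by rewrite leNgt; apply/negP => lt; apply: no; exists i.
have jumps i : q 0%N + i%:R * delta <= q (i * k)%N.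
  elim: i => [|i IH]; first by rewrite mul0r addr0.
  by rewrite mulSn addnC -natr1; apply: le_trans (step _); move: IH; lra.
have turns j : q (j * n)%N = q 0%N + j%:R.
  elim: j => [|j IH]; first by rewrite addr0.
  by rewrite mulSn addnC qn IH -natr1 addrA.
by have := jumps n; rewrite mulnC turns; lra.
Qed.

Definition pierced (T : finType) (p : T -> R) (x : R) : {set T} :=
  [set i | `[< pierces (p i) x >]].

Lemma pigeonhole (T : finType) (p : T -> R) (A : {set T}) (k : nat) :
  delta <= 1 -> k%:R < #|A|%:R * delta ->
  exists x, (k < #|A :&: pierced p x|)%N.
Proof.
move=> d1 kA.
(* so that the k + 1 arcs of a window have different labels *)
have kltA : (k < #|A|)%N.
  by rewrite -(ltr_nat R); have : 0 <= #|A|%:R :> R by []; nra.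
case cA : #|A| kA kltA => [|n] // kA kltA.
pose lab (i : 'I_n.+1) : T := enum_val (cast_ord (esym cA) i).
have lab_inj : injective lab by move=> i j /enum_val_inj/cast_ord_inj.
have [s [q [qle qn qp sinj]]] := cyclic_sort (p \o lab).
have [i ltk] := crowded_window qn kA.
have [x xP] := window_pierced qle qp ltk.
exists x; pose g (t : 'I_k.+1) := lab (s (i + t)%N).
have g_inj : injective g.
  move=> t u /lab_inj/sinj/eqP; rewrite eqn_modDl => /eqP.
  by rewrite !modn_small ?(leq_ltn_trans (leq_ord _)) // => /val_inj.
rewrite -[k.+1]card_ord -(card_imset _ g_inj) subset_leq_card //.
apply/fintype.subsetP => _ /imsetP[t _ ->]; rewrite !inE enum_valP /=.
by apply/asboolP/xP; rewrite -ltnS.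
Qed.

(** A form of the pigeonhole principle that only needs an upper bound n for
    #|A|: since delta <= 1, removing one arc lowers the total length, in the
    inequality k < n * delta, by no more than 1. *)
Lemma pierce_down (T : finType) (p : T -> R) (A : {set T}) (n k : nat) :
  delta <= 1 -> (#|A| <= n)%N -> k%:R < n%:R * delta ->
  exists x, (#|A :\: pierced p x| <= n - k.+1)%N.
Proof.
move=> d1 An kn; have [small|large] := leqP #|A| (n - k.+1).
  by exists 0; rewrite (leq_trans _ small) // subset_leq_card // subsetDl.
have [x] : exists x, (#|A| + k - n < #|A :&: pierced p x|)%N.
  apply: pigeonhole => //.
  have e : (#|A| + k - n)%N%:R + n%:R = #|A|%:R + k%:R :> R.
    by rewrite -!natrD subnK //; lia.
  have : #|A|%:R <= n%:R :> R by rewrite ler_nat.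
  by nra.
by exists x; have := cardsID (pierced p x) A; lia.
Qed.

End Piercing.

(** * Piercing one arc of each index *)

Section Unpierced.
Variables (R : realType) (delta : R).
Hypothesis delta_le1 : delta <= 1.

Definition unpierced (n : nat) (p1 p2 p3 : 'I_n -> R) : Prop :=
  forall x y z, exists i,
    [/\ ~ pierces delta (p1 i) x, ~ pierces delta (p2 i) y &
        ~ pierces delta (p3 i) z].

Lemma unpierced_rot n (p1 p2 p3 : 'I_n -> R) :
  unpierced p1 p2 p3 -> unpierced p2 p3 p1.
Proof. by move=> cov x y z; have [i []] := cov z x y; exists i. Qed.

Lemma unpierced_card n (p1 p2 p3 : 'I_n -> R) x y z :
  unpierced p1 p2 p3 ->
  (0 < #|~: pierced delta p1 x :\: pierced delta p2 y
            :\: pierced delta p3 z|)%N.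
Proof.
move=> /(_ x y z)[i [n1 n2 n3]]; apply/card_gt0P; exists i; rewrite !inE.
by apply/and3P; split; apply/negP => /asboolP.
Qed.

(** Here n1, n2, n3 bound the numbers of indices still to be pierced before the
    choices of x, y and z. *)
Lemma not_unpierced_greedy (n1 n2 n3 k1 k2 k3 : nat) (p1 p2 p3 : 'I_n1 -> R) :
  (n1 <= n2 + k1.+1)%N -> (n2 <= n3 + k2.+1)%N -> (n3 <= k3.+1)%N ->
  k1%:R < n1%:R * delta -> k2%:R < n2%:R * delta -> k3%:R < n3%:R * delta ->
  ~ unpierced p1 p2 p3.
Proof.
move=> n12 n23 n3k c1 c2 c3 cov.
have [x xP] : exists x, (#|~: pierced delta p1 x| <= n2)%N.
  have all_n1 : (#|[set: 'I_n1]%SET| <= n1)%N by rewrite cardsT card_ord.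
  have [x] := pierce_down p1 delta_le1 all_n1 c1.
  by rewrite finset.setTD => xP; exists x; lia.
have [y yP] : exists y,
    (#|~: pierced delta p1 x :\: pierced delta p2 y| <= n3)%N.
  by have [y yP] := pierce_down p2 delta_le1 xP c2; exists y; lia.
have [z zP] := pierce_down p3 delta_le1 yP c3.
by have := unpierced_card x y z cov; lia.
Qed.

End Unpierced.

(** * Seven arcs longer than 2/5 *)

Section SevenArcs.
Variables (R : realType) (delta : R).
Hypotheses (delta_gt : 2 / 5 < delta) (delta_le1 : delta <= 1).

(** As no four arcs share a point, the third arc after a given one does not
    start before its end.  Hence six consecutive gaps between starts add up to at
    least 2 * delta > 4/5, each gap is less than 1/5, and the second arc after a
    given one still meets it. *)
Lemma cyclic_triples (p : 'I_7 -> R) :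
  (forall x, (#|pierced delta p x| <= 3)%N) ->
  exists2 s : 'I_7 -> 'I_7, injective s &
    forall k : 'I_7, exists x,
      {in [:: k; k + 1; k + 2], forall i, pierces delta (p (s i)) x}.
Proof.
move=> depth3; have [s [q [qle qn qp sinj]]] := cyclic_sort p.
have far3 k : q k + delta <= q (k + 3)%N.
  rewrite leNgt; apply/negP => /(window_pierced qle qp)[x xP].
  have g_inj : injective (fun t : 'I_4 => s (k + t)%N).
    move=> t u /sinj/eqP; rewrite eqn_modDl => /eqP.
    by rewrite !modn_small ?(leq_trans (ltn_ord _)) // => /val_inj.
  have card4 : #|[set s (k + t)%N | t : 'I_4]| = 4%N.
    by rewrite card_imset // card_ord.
  suff /subset_leq_card : [set s (k + t)%N | t : 'I_4] \subset pierced delta p x.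
    by have := depth3 x; rewrite card4; lia.
  apply/fintype.subsetP => _ /imsetP[t _ ->]; rewrite inE.
  by apply/asboolP/xP; rewrite -ltnS.
have near2 k : q (k + 2)%N < q k + delta.
  have gap i : q (i + 1)%N <= q i + (1 - 2 * delta).
    have := far3 (i + 1)%N; have := far3 (i + 1 + 3)%N.
    have -> : (i + 1 + 3 + 3 = i + 7)%N by lia.
    by rewrite qn; lra.
  have := gap k; have := gap (k + 1)%N; rewrite -addnA.
  by move: delta_gt; lra.
have smod i : s (i %% 7)%N = s i by apply/sinj; rewrite modn_mod.
exists (fun i => s i) => [i j /sinj|k].
  by rewrite !modn_small // => /val_inj.
have [x xP] := window_pierced qle qp (near2 k); exists x => i.
have xS (t : nat) : (t <= 2)%N -> pierces delta (p (s ((k + t) %% 7)%N)) x.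
  by move=> t2; rewrite smod; exact: xP.
rewrite !inE => /or3P[] /eqP->.
- by have := xP 0%N isT; rewrite addn0.
- exact: xS 1%N isT.
- exact: xS 2%N isT.
Qed.

(** If x pierced four indices, then y could pierce two of the other three, as
    3 * delta > 1, and z the last one. *)
Lemma depth_le3 (p1 p2 p3 : 'I_7 -> R) (x : R) :
  unpierced delta p1 p2 p3 -> (#|pierced delta p1 x| <= 3)%N.
Proof.
move=> cov; rewrite leqNgt; apply/negP => deep.
have few : (#|~: pierced delta p1 x| <= 3)%N.
  by have := cardsC (pierced delta p1 x); rewrite card_ord; lia.
have [y yP] : exists y,
    (#|~: pierced delta p1 x :\: pierced delta p2 y| <= 3 - 2)%N.
  by apply: pierce_down => //; move: delta_gt; lra.
have [z zP] : exists z, (#|~: pierced delta p1 x :\: pierced delta p2 y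
                             :\: pierced delta p3 z| <= 1 - 1)%N.
  by apply: pierce_down => //; move: delta_gt; lra.
by have := unpierced_card x y z cov; lia.
Qed.

Lemma seven_arcs_pierced (p1 p2 p3 : 'I_7 -> R) : ~ unpierced delta p1 p2 p3.
Proof.
move=> cov.
have cov2 := unpierced_rot cov; have cov3 := unpierced_rot cov2.
have [s1 s1i t1] := cyclic_triples (fun x => depth_le3 x cov).
have [s2 s2i t2] := cyclic_triples (fun x => depth_le3 x cov2).
have [s3 s3i t3] := cyclic_triples (fun x => depth_le3 x cov3).
have pair (p : 'I_7 -> R) (s : 'I_7 -> 'I_7) (si : injective s) (u v : 'I_7) :
    (forall k : 'I_7, exists x,
       {in [:: k; k + 1; k + 2], forall i, pierces delta (p (s i)) x}) ->
    ~~ far (invF si u) (invF si v) ->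
    exists x, pierces delta (p u) x /\ pierces delta (p v) x.
  move=> trip /near_window[k /andP[uk vk]]; have [x xP] := trip k; exists x.
  by split; [rewrite -(f_invF si u)|rewrite -(f_invF si v)]; exact: xP.
have r2i : injective (invF s2i \o s1).
  by apply: inj_comp s1i; exact: can_inj (f_invF s2i).
have r3i : injective (invF s3i \o s1).
  by apply: inj_comp s1i; exact: can_inj (f_invF s3i).
have [i [a [b [c [d [abcd ab cd]]]]]] := three_cyclic_orders r2i r3i.
have [x xP] := t1 (i + 4).
have [y [ya yb]] := pair p2 s2 s2i _ _ t2 ab.
have [z [zc zd]] := pair p3 s3 s3i _ _ t3 cd.
have [l [l1 l2 l3]] := cov x y z.
have [k lk] : exists k, l = s1 k by exists (invF s1i l); rewrite f_invF.
have : k \in [:: i; i + 1; i + 2; i + 3] ++ [:: i + 4; i + 4 + 1; i + 4 + 2].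
  have : all (fun i : 'I_7 => all (fun k => k \in
    [:: i; i + 1; i + 2; i + 3] ++ [:: i + 4; i + 4 + 1; i + 4 + 2]) I7) I7
    by vm_compute.
  by move=> /all_I7P/(_ i)/all_I7P/(_ k).
rewrite mem_cat -(perm_mem abcd) => /orP[|kx]; last first.
  by apply: l1; rewrite lk; exact: xP.
rewrite !inE => /or4P[] /eqP kE; [apply: l2|apply: l2|apply: l3|apply: l3];
  by rewrite lk kE.
Qed.

End SevenArcs.

(** * Coverings of the torus *)

Local Open Scope quotient_scope.

Section Covers.
Variables (R : realType) (eps : R).

Lemma coverable_gt0 d n : coverable d eps n -> (0 < n)%N.
Proof.
case: n => // -[c cT].
have : [set: torus R d]%classic [ffun=> \pi_(circle R) 0] by [].
by rewrite -cT => -[[]].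
Qed.

Lemma coverableW d m n : coverable d eps m -> (m <= n)%N -> coverable d eps n.
Proof.
move=> cov; have m0 := coverable_gt0 cov; case: cov => c cT mn.
(* the additional cubes repeat the first one *)
exists (fun i : 'I_n => c (insubd (Ordinal m0) (val i))).
apply/seteqP; split=> // x _.
have : (\bigcup_i subcube eps (c i))%classic x by rewrite cT.
move=> [i _ xi]; exists (widen_ord mn i) => //=.
by rewrite /insubd valK.
Qed.

Lemma mu_eq d n :
  coverable d eps n.+1 -> ~ coverable d eps n -> mu d eps = n.+1.
Proof.
move=> cov nocov; have least m : coverable d eps m -> (n.+1 <= m)%N.
  by move=> covm; rewrite ltnNge; apply/negP => /(coverableW covm).
apply: xget_unique => [//|m [covm mle]].
by apply/eqP; rewrite eqn_leq mle // least.
Qed.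

(** The complement of the closed arc [c, c + eps] is the open arc of length
    1 - eps that starts where the closed one ends. *)
Lemma pierces_arcC (c : circle R) (x : R) :
  pierces (1 - eps) (repr c + eps) x -> ~ circle_arc eps c (\pi_(circle R) x).
Proof.
move=> [m mx] [t /= tc /circle_eqP/intrP[z tx]].
have : - z%:~R < (m + 1)%:~R :> R by rewrite intrD; lra.
have : m%:~R < - z%:~R :> R by lra.
by rewrite -!intrN !ltr_int; lia.
Qed.

Lemma coverable_unpierced n : coverable 3 eps n ->
  exists p1 p2 p3 : 'I_n -> R, unpierced (1 - eps) p1 p2 p3.
Proof.
move=> [c cT]; pose p j i := repr (c i j) + eps.
exists (p 0), (p 1), (p 2) => x y z.
pose w : torus R 3 :=
  [ffun j : 'I_3 => \pi_(circle R) (nth 0 [:: x; y; z] j)].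
have : (\bigcup_i subcube eps (c i))%classic w by rewrite cT.
move=> [i _ wi]; exists i.
by split=> /pierces_arcC; apply;
  [have := wi 0|have := wi 1|have := wi 2]; rewrite /w ffunE.
Qed.

Lemma not_coverable_greedy (n n2 n3 k1 k2 k3 : nat) : 0 < eps ->
  (n <= n2 + k1.+1)%N -> (n2 <= n3 + k2.+1)%N -> (n3 <= k3.+1)%N ->
  k1%:R < n%:R * (1 - eps) -> k2%:R < n2%:R * (1 - eps) ->
  k3%:R < n3%:R * (1 - eps) -> ~ coverable 3 eps n.
Proof.
move=> eps0 n12 n23 n3k c1 c2 c3 /coverable_unpierced[p1 [p2 [p3]]].
by apply: not_unpierced_greedy n12 n23 n3k c1 c2 c3; lra.
Qed.

(** If t lies in a cell of the grid of step 1/q whose index is u + a modulo q,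
    with u < r, then t is, modulo 1, in the arc from a/q to (a + r)/q. *)
Lemma grid_arc (q r a u : nat) (k : int) (t : R) :
  (0 < q)%N -> r%:R / q%:R <= eps -> (u < r)%N ->
  Num.floor (q%:R * t) = a%:Z + u%:Z + k * q%:Z ->
  circle_arc eps (\pi_(circle R) (a%:R / q%:R)) (\pi_(circle R) t).
Proof.
move=> q0 rq ur Ft; rewrite circle_arc_pi.
have qR : 0 < q%:R :> R by rewrite ltr0n.
exists (t - k%:~R); last first.
  by apply/circle_eqP; rewrite addrAC subrr sub0r rpredN intr_int.
have := floor_itv (q%:R * t); rewrite Ft !intrD intrM -!pmulrn => qt.
have ur1 : u%:R + 1 <= r%:R :> R by rewrite natr1 ler_nat.
have u0 : 0 <= u%:R :> R by [].
rewrite /= ler_pdivrMr // -lerBlDl; apply/andP; split; first by lra.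
by apply: le_trans rq; rewrite ler_pdivlMr // mulrBl divfK ?gt_eqF //; lra.
Qed.

(** A covering of the discrete torus (Z/q)^3 by n cubes of side r, where a i is
    the corner of the i-th one, gives one of the torus: a point belongs to the
    cubes that cover its cell.  The condition a i j <= q ensures that
    b j + (q - a i j) represents b j - a i j modulo q. *)
Lemma grid_cover (q r n : nat) (a : 'I_n -> 'I_3 -> nat) :
  (0 < q)%N -> r%:R / q%:R <= eps ->
  (forall b : 'I_3 -> nat, (forall j, b j < q)%N ->
    exists i, forall j, (a i j <= q)%N && ((b j + (q - a i j)) %% q < r)%N) ->
  coverable 3 eps n.
Proof.
move=> q0 rq grid.
exists (fun i => [ffun j => \pi_(circle R) ((a i j)%:R / q%:R)]).
apply/seteqP; split=> // x _.
pose F j := Num.floor (q%:R * repr (x j)).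
have Fmod j : (0 <= F j %% q < q)%Z.
  by rewrite modz_ge0 ?ltz_pmod //; lia.
have [|i iP] := grid (fun j => `|(F j %% q)%Z|%N).
  by move=> j; have := Fmod j; lia.
exists i => // j; rewrite ffunE -[x j]reprK.
case/andP: (iP j) => aq ur.
pose w := (`|(F j %% q)%Z| + (q - a i j))%N.
apply: (@grid_arc q r (a i j) (w %% q) ((w %/ q)%N%:Z - 1 + (F j %/ q)%Z)
          _ q0 rq ur).
have wE : w%:Z = (F j %% q)%Z + q%:Z - (a i j)%:Z.
  by rewrite /w; have := Fmod j; lia.
rewrite -/(F j) [LHS](divz_eq (F j) q).
by move: wE; rewrite {1}(divn_eq w q) PoszD PoszM => wE; lia.
Qed.

End Covers.

Definition grid_covers (q r : nat) (l : seq (nat * nat * nat)) : bool :=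
  all (fun b1 => all (fun b2 => all (fun b3 =>
    has (fun t =>
      all (fun ab => (ab.1 <= q) && ((ab.2 + (q - ab.1)) %% q < r))%N
        [:: (t.1.1, b1); (t.1.2, b2); (t.2, b3)]) l)
  (iota 0 q)) (iota 0 q)) (iota 0 q).

Lemma coverable_grid (R : realType) (eps : R) (q r : nat)
    (l : seq (nat * nat * nat)) :
  (0 < q)%N -> grid_covers q r l -> r%:R / q%:R <= eps ->
  coverable 3 eps (size l).
Proof.
move=> q0 /allP gl rq.
pose corner i (j : 'I_3) : nat :=
  let t := nth (0, 0, 0)%N l i in nth 0%N [:: t.1.1; t.1.2; t.2] j.
apply: (@grid_cover R eps q r (size l) corner q0 rq) => b bq.
have biota j : b j \in iota 0 q by rewrite mem_iota bq.
have /allP/(_ _ (biota 1))/allP/(_ _ (biota 2)) := gl _ (biota 0).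
move=> /hasP[t tl /and4P[t0 t1 t2 _]].
have ti : (index t l < size l)%N by rewrite index_mem.
exists (Ordinal ti) => j; rewrite /corner /= nth_index //.
case: j => [[|[|[|//]]] lt3].
- by rewrite (_ : Ordinal lt3 = 0); [exact: t0 | exact: val_inj].
- by rewrite (_ : Ordinal lt3 = 1); [exact: t1 | exact: val_inj].
- by rewrite (_ : Ordinal lt3 = 2); [exact: t2 | exact: val_inj].
Qed.

Theorem theorem5 (R : realType) (eps : R) :
  [/\ 3 / 4 <= eps < 1 -> mu 3 eps = 4%N,
      2 / 3 <= eps < 3 / 4 -> mu 3 eps = 5%N,
      3 / 5 <= eps < 2 / 3 -> mu 3 eps = 7%N
    & 1 / 2 <= eps < 3 / 5 -> mu 3 eps = 8%N].
Proof.
split=> /andP[le_eps eps_lt]; apply: mu_eq.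
- by apply: (@coverable_grid _ _ 4 3
    [:: (0, 0, 0); (1, 1, 1); (2, 2, 2); (3, 3, 3)]%N).
- apply: (@not_coverable_greedy _ _ 3 2 1 0 0 0) => //; lra.
- by apply: (@coverable_grid _ _ 3 2
    [:: (0, 0, 0); (2, 2, 2); (0, 1, 1); (1, 0, 1); (1, 1, 0)]%N).
- apply: (@not_coverable_greedy _ _ 4 2 1 1 0 0) => //; lra.
- by apply: (@coverable_grid _ _ 5 3
    [:: (0, 0, 0); (4, 3, 3); (3, 0, 2); (3, 2, 0); (1, 1, 3); (1, 3, 1);
        (2, 4, 4)]%N).
- apply: (@not_coverable_greedy _ _ 6 3 1 2 1 0) => //; lra.
- by apply: (@coverable_grid _ _ 2 1
    [:: (0, 0, 0); (0, 0, 1); (0, 1, 0); (0, 1, 1);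
        (1, 0, 0); (1, 0, 1); (1, 1, 0); (1, 1, 1)]%N).
- by move=> /coverable_unpierced[p1 [p2 [p3]]]; apply: seven_arcs_pierced; lra.
Qed.
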